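(* Let $w$ be a double occurrence word in ascending order and let $\nu\ge 1$. Let $\mathcal{I}_1(\nu,k_1,\ell_1)$ and $\mathcal{I}_2(\nu,k_2,\ell_2)$ be two insertions into $w$ with $(k_1,\ell_1)\neq(k_2,\ell_2)$ and $k_1<k_2$, and put $w_i=w\star\mathcal{I}_i(\nu,k_i,\ell_i)$ for $i=1,2$. Let $p_1\le p_2\le p_3\le p_4$ be the numbers $k_1,\ell_1,k_2,\ell_2$ listed in nondecreasing order, and write $w=z_0z_1z_2z_3z_4$ with $|z_0|=p_1-1$, $|z_0z_1|=p_2-1$, $|z_0z_1z_2|=p_3-1$, $|z_0z_1z_2z_3|=p_4-1$. If $w_1\sim w_2$, then: (a) if $k_1<k_2\le\ell_1<\ell_2$ (interleaving) and $\mathcal{I}_1,\mathcal{I}_2\in\mathrm{Rep}$, then $z_1z_3$ is a repeat word; (b) if $k_1<k_2\le\ell_1<\ell_2$ and $\mathcal{I}_1,\mathcal{I}_2\in\mathrm{Ret}$, then $|z_1|/\nu$ is a positive integer and $z_1z_3\sim \mathrm{Int}(|z_1|/\nu,\nu)$; (c) if $k_1<k_2\le\ell_2<\ell_1$ (nested) and $\mathcal{I}_1,\mathcal{I}_2\in\mathrm{Rep}$, then $|z_1|/\nu$ is a positive integer and $z_1z_3\sim \mathrm{Nes}(|z_1|/\nu,\nu)$; (d) if $k_1<k_2\le\ell_2<\ell_1$ and $\mathcal{I}_1,\mathcal{I}_2\in\mathrm{Ret}$, then $z_1z_3$ is a return word; (e) if $k_1\le\ell_1<k_2\le\ell_2$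 (sequential) and $\mathcal{I}_1,\mathcal{I}_2\in\mathrm{Rep}$, then $|z_2|/(2\nu)$ is a positive integer and $z_1z_2z_3\sim T_\rho(\nu,|z_1|,|z_2|/(2\nu))$; (f) if $k_1\le\ell_1<k_2\le\ell_2$ and $\mathcal{I}_1,\mathcal{I}_2\in\mathrm{Ret}$, then $|z_2|/(2\nu)$ is a positive integer, $\nu$ divides $|z_1|$, and $z_1z_2z_3\sim T_\tau(\nu,|z_1|,|z_2|/(2\nu))$.
   Context: Alphabet $\Sigma=\mathbb{N}=\{1,2,\dots\}$; $\Sigma^*$ is the set of finite words (including the empty word $\epsilon$), $|w|$ is length, $w^R$ is the reverse of $w$, $\Sigma[w]$ is the set of symbols occurring in $w$. A double occurrence word (DOW) is a word in which every symbol occurs either zero or exactly two times; a single occurrence word (SOW) is a nonempty word whose symbols are pairwise distinct. An equivalence map is a morphism of $\Sigma^*$ induced by a bijection $\Sigma\to\Sigma$; $x\sim y$ means $f(x)=y$ for some equivalence map $f$. A word is in ascending order if it is empty or its first symbol is $1$ and the first occurrence of each symbol is one greater than the largest symbol preceding it. A word $x$ is a repeat word if $x=vv$ for a SOW $v$, and a return word if $x=vv^R$ for a SOW $v$. Insertions: let $w$ be a DOW in ascending order, $M$ its largest symbol ($M=0$ if $w=\epsilon$), $\nu\ge1$, and $u=(M+1)(M+2)\cdots(M+\nu)$. For integers $1\le k\le\ell\le|w|+1$ write $w=y_1y_2y_3$ with $|y_1|=k-1$, $|y_1y_2|=\ell-1$. The repeat insertion $\rho(\nu,k,\ell)$ gives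 $w\star\rho(\nu,k,\ell)=y_1uy_2uy_3$ and the return insertion $\tau(\nu,k,\ell)$ gives $w\star\tau(\nu,k,\ell)=y_1uy_2u^Ry_3$. $\mathcal{I}(\nu,k,\ell)$ denotes an insertion of either kind; $\mathcal I\in\mathrm{Rep}$ means it is a repeat insertion and $\mathcal I\in\mathrm{Ret}$ a return insertion (for $\nu=1$ they coincide and belong to both). For $h,\nu\ge1$ let $x_i=((i-1)\nu+1)((i-1)\nu+2)\cdots(i\nu)$ for $1\le i\le h$; then $\mathrm{Int}(h,\nu)=x_1x_2\cdots x_hx_1^Rx_2^R\cdots x_h^R$ and $\mathrm{Nes}(h,\nu)=x_1x_2\cdots x_hx_hx_{h-1}\cdots x_1$. Tangled cords: for integers $m\ge0$, $\nu,j\ge1$, let $s_0=12\cdots m12\cdots m$ ($s_0=\epsilon$ if $m=0$) and $s_j=s_{j-1}\star\rho(\nu,|s_{j-1}|-m+1,|s_{j-1}|+1)$; set $T_\rho(\nu,m,j)=s_j$. If moreover $\nu$ divides $m$, let $t_0=\mathrm{Int}(m/\nu,\nu)$ ($t_0=\epsilon$ if $m=0$) and $t_j=t_{j-1}\star\tau(\nu,|t_{j-1}|-m+1,|t_{j-1}|+1)$; set $T_\tau(\nu,m,j)=t_j$. *)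

(* Defs.v *)
From mathcomp Require Import all_boot.

Set Implicit Arguments.
Unset Strict Implicit.
Unset Printing Implicit Defensive.

(* The alphabet is {1, 2, ...}; 0 is not a symbol. *)
Definition is_word (w : seq nat) : Prop := 0 \notin w.

Definition DOW (w : seq nat) : Prop :=
  is_word w /\ forall a : nat, count_mem a w = 0 \/ count_mem a w = 2.

Definition SOW (w : seq nat) : Prop := [/\ is_word w, w <> [::] & uniq w].

(* Permutations of {1, 2, ...} are encoded as permutations of nat fixing 0. *)
Definition equivalent (x y : seq nat) : Prop :=
  exists f : nat -> nat, [/\ bijective f, f 0 = 0 & map f x = y].

Definition max_symbol (w : seq nat) : nat := \max_(a <- w) a.

Definition ascending (w : seq nat) : Prop :=
  w = [::] \/
  nth 0 w 0 = 1 /\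
  forall i : nat, 0 < i < size w -> nth 0 w i \notin take i w ->
    nth 0 w i = (max_symbol (take i w)).+1.

Definition repeat_word (x : seq nat) : Prop :=
  exists v : seq nat, SOW v /\ x = v ++ v.

Definition return_word (x : seq nat) : Prop :=
  exists v : seq nat, SOW v /\ x = v ++ rev v.

Inductive ins_kind := Repeat | Return.

Record insertion := Insertion
  { kind_of : ins_kind; nu_of : nat; k_of : nat; l_of : nat }.

Definition rho (nu k l : nat) : insertion := Insertion Repeat nu k l.
Definition tau (nu k l : nat) : insertion := Insertion Return nu k l.

Definition valid_insertion (w : seq nat) (I : insertion) : Prop :=
  [/\ 1 <= nu_of I, 1 <= k_of I, k_of I <= l_of I & l_of I <= size w + 1].

(* For nu = 1 the two kinds of insertion coincide and belong to both classes. *)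
Definition in_Rep (I : insertion) : Prop := kind_of I = Repeat \/ nu_of I = 1.
Definition in_Ret (I : insertion) : Prop := kind_of I = Return \/ nu_of I = 1.

(* Meaningful only when valid_insertion w I holds. *)
Definition insert (w : seq nat) (I : insertion) : seq nat :=
  let y1 := take (k_of I - 1) w in
  let y2 := drop (k_of I - 1) (take (l_of I - 1) w) in
  let y3 := drop (l_of I - 1) w in
  let u := iota (max_symbol w + 1) (nu_of I) in
  let u' := match kind_of I with Repeat => u | Return => rev u end in
  y1 ++ u ++ y2 ++ u' ++ y3.

(* The word x_i = ((i-1)nu+1) ((i-1)nu+2) ... (i nu), for i >= 1. *)
Definition block (nu i : nat) : seq nat := iota ((i - 1) * nu + 1) nu.

Definition Int (h nu : nat) : seq nat :=
  flatten [seq block nu i | i <- iota 1 h] ++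
  flatten [seq rev (block nu i) | i <- iota 1 h].

Definition Nes (h nu : nat) : seq nat :=
  flatten [seq block nu i | i <- iota 1 h] ++
  flatten [seq block nu i | i <- rev (iota 1 h)].

Fixpoint T_rho (nu m j : nat) : seq nat :=
  match j with
  | 0 => iota 1 m ++ iota 1 m
  | j'.+1 =>
      let s := T_rho nu m j' in
      insert s (rho nu (size s - m + 1) (size s + 1))
  end.

(* Meaningful only when nu divides m. *)
Fixpoint T_tau (nu m j : nat) : seq nat :=
  match j with
  | 0 => Int (m %/ nu) nu
  | j'.+1 =>
      let t := T_tau nu m j' in
      insert t (tau nu (size t - m + 1) (size t + 1))
  end.

(* Main.v *)
(* Let [f] carry [w * I1] to [w * I2], where both insertions add the word [u]
   (and its copy or reverse [u']).  Comparing factors at equal positions, [f]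
   carries [u z1] to [z1 u], and [u' z3] to [z3 u'] in the interleaving case;
   in the nested case [z3 u'] goes to [u' z3], which is the interleaving case
   of the other kind for the reverse of [z3].  Hence [z1] begins
   [f(u) f(f(u)) ...] and [z3] (or its reverse) begins [f(u') f(f(u')) ...],
   and each of them ends just before [u] or [u'] reappears, which makes the
   lengths agree, and makes them multiples of [nu] if [u'] is the reverse of
   [u].  In the sequential case [f] carries [u z1 u' z2 z3] to [z1 z2 u z3 u'],
   and removing the last insertion from [z1 z2 z3] preserves this equation up
   to renaming one copy of [u] while shortening [z2] by [2 nu]. *)
Require Import Defs.
From mathcomp Require Import all_boot.
From mathcomp Require Import zify.

Set Implicit Arguments.
Unset Strict Implicit.
Unset Printing Implicit Defensive.

(** * Counting symbols and building renamings *)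

Lemma cat_inj_size (T : Type) (s1 s2 t1 t2 : seq T) :
  size s1 = size t1 -> s1 ++ s2 = t1 ++ t2 -> s1 = t1 /\ s2 = t2.
Proof.
elim: s1 t1 => [|a s1 IH] [|b t1] //= [sz] [<- eqst].
by have [-> ->] := IH _ sz eqst.
Qed.

Lemma uniq_count_le1 (T : eqType) (s : seq T) :
  (forall a, count_mem a s <= 1) -> uniq s.
Proof.
move=> le1; apply: count_mem_uniq => a; have := le1 a.
by rewrite -has_pred1 has_count; case: (count_mem a s) => [|[|]].
Qed.

(** Each symbol occurs equally often in both halves, so a total of at most two leaves at most one
    for each half. *)
Lemma uniq_perm_halves (T : eqType) (x y : seq T) :
  perm_eq x y -> (forall a, count_mem a (x ++ y) <= 2) -> uniq x.
Proof.
move=> /permP pxy le2; apply: uniq_count_le1 => a.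
by have := le2 a; rewrite count_cat -pxy; lia.
Qed.

Lemma count_subseq (T : eqType) (a : pred T) (s t : seq T) :
  subseq s t -> count a s <= count a t.
Proof.
case/subseqP=> m _ ->; elim: t m => [|x t IH] [|[] m] //=.
- by rewrite leq_add2l.
- by apply: leq_trans (IH m) _; rewrite leq_addl.
Qed.

Definition swap (T : eqType) (a b x : T) : T :=
  if x == a then b else if x == b then a else x.

Lemma swapK (T : eqType) (a b : T) : involutive (swap a b).
Proof.
move=> x; rewrite /swap; case: (x =P a) => [->|/eqP xa].
  by case: (b =P a) => [->|_] //; rewrite eqxx.
case: (x =P b) => [->|/eqP xb]; first by rewrite eqxx.
by rewrite (negbTE xa) (negbTE xb).
Qed.

(** The bijection for the tails is followed by the transposition of [f a] and [b]. Both lie outside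
    [X] and [t], so nothing already arranged is disturbed. *)
Lemma bij_extend (T : eqType) (X s t : seq T) :
    uniq s -> uniq t -> size s = size t ->
    (forall a, a \in s -> a \notin X) -> (forall a, a \in t -> a \notin X) ->
  exists f : T -> T,
    [/\ bijective f, map f s = t & {in X, forall a, f a = a}].
Proof.
elim: s t => [|a s IH] [|b t] //=; first by exists id; split=> //; exists id.
case/andP=> as_ us /andP[bt ut] [sz] sX tX.
have [||f [bf fst fX]] := IH t us ut sz.
- by move=> c cs; apply: sX; rewrite inE cs orbT.
- by move=> c ct; apply: tX; rewrite inE ct orbT.
have injf := bij_inj bf.
have fat : f a \notin t by rewrite -fst mem_map.
have faX : f a \notin X.
  apply/negP => faX; have /negP := sX a (mem_head _ _); apply.
  by rewrite -(injf _ _ (fX _ faX)).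
have bX := tX b (mem_head _ _).
have fix_ c : c != f a -> c != b -> swap (f a) b c = c.
  by rewrite /swap => /negbTE -> /negbTE ->.
exists (swap (f a) b \o f); split.
- exact: bij_comp (inv_bij (swapK _ _)) bf.
- rewrite /= {1}/swap eqxx map_comp fst; congr cons.
  rewrite -[RHS]map_id; apply/eq_in_map => c ct; apply: fix_.
    by apply: contraNneq fat => <-.
  by apply: contraNneq bt => <-.
- move=> c cX /=; rewrite (fX _ cX) fix_ //.
    by apply: contraNneq faX => <-.
  by apply: contraNneq bX => <-.
Qed.

Lemma equivalent_iota (s : seq nat) : uniq s -> is_word s ->
  exists f, [/\ bijective f, f 0 = 0 & map f s = iota 1 (size s)].
Proof.
move=> us ws; have [|||f [bf fs f0]] :=
  @bij_extend _ [:: 0] s (iota 1 (size s)) us (iota_uniq _ _).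
- by rewrite size_iota.
- by move=> a as_; rewrite inE; apply: contraNneq ws => <-.
- by move=> a; rewrite mem_iota inE; case: a.
by exists f; split=> //; apply: f0; rewrite inE.
Qed.

(** The given renaming is followed by a bijection that moves the images of [s] to [t] and fixes both
    [y] and the non-symbol 0. *)
Lemma equivalent_extend (x y s t : seq nat) :
    equivalent x y -> is_word x -> is_word s -> is_word t ->
    uniq s -> uniq t -> size s = size t ->
    (forall a, a \in s -> a \notin x) -> (forall a, a \in t -> a \notin y) ->
  exists f, [/\ bijective f, f 0 = 0, map f x = y & map f s = t].
Proof.
case=> g [bg g0 gxy] wx ws wt us ut sz sx ty; have injg := bij_inj bg.
have [||||h [bh hst hy]] := @bij_extend _ (0 :: y) (map g s) t _ ut.
- by rewrite map_inj_uniq.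
- by rewrite size_map.
- move=> _ /mapP[a as_ ->]; rewrite inE negb_or -{1}g0 (inj_eq injg) -gxy.
  rewrite mem_map // sx // andbT; by apply: contraNneq ws => <-.
- move=> a at_; rewrite inE negb_or ty // andbT.
  by apply: contraNneq wt => <-.
exists (h \o g); split.
- exact: bij_comp.
- by rewrite /= g0 hy ?mem_head.
- rewrite map_comp gxy -[RHS]map_id; apply/eq_in_map => c cy.
  by apply: hy; rewrite inE cy orbT.
- by rewrite map_comp.
Qed.

(** * Cancellation: solving the equations that relate a word to its shift by [u] *)

(** The second copy of an inserted word, so that one argument serves both kinds of insertion. *)
Definition twist (T : Type) (c : ins_kind) (s : seq T) : seq T :=
  match c with Repeat => s | Return => rev s end.
Arguments twist {T} c s.

Lemma size_twist (T : Type) c (s : seq T) : size (twist c s) = size s.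
Proof. by case: c => //=; rewrite size_rev. Qed.

Lemma map_twist (T U : Type) (f : T -> U) c s :
  map f (twist c s) = twist c (map f s).
Proof. by case: c => //=; rewrite map_rev. Qed.

Lemma mem_twist (T : eqType) c (s : seq T) : twist c s =i s.
Proof. by case: c => a //; apply: mem_rev. Qed.

Lemma uniq_twist (T : eqType) c (s : seq T) : uniq (twist c s) = uniq s.
Proof. by case: c => //=; rewrite rev_uniq. Qed.

(* The first symbol of [x ++ v] is the image of the first symbol of [u], so
   moving it to the end of [u] preserves the shape of the hypotheses. *)
Lemma repeat_cancel (T : eqType) (f : T -> T) (u v x y : seq T) :
    u <> [::] -> (forall a, a \in v -> a \notin x) ->
    (forall a, a \in v -> a \notin y) ->
    map f (u ++ x) = x ++ v -> map f (u ++ y) = y ++ v -> x = y.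
Proof.
case: v => [|d v]; elim: x u y => [|b x IH] [|a u] [|c y] //= _ vx vy.
- by case=> <- eqx [<- eqy]; congr cons; apply: (IH (rcons u (f a)));
    rewrite ?cat_rcons //; case: (u).
- by case=> eqd _ [eqc _]; have /negP[] := vy d (mem_head _ _); rewrite -eqd eqc mem_head.
- by case=> eqb _ [eqd _]; have /negP[] := vx d (mem_head _ _); rewrite -eqd eqb mem_head.
case=> <- eqx [<- eqy]; congr cons; apply: (IH (rcons u (f a))).
- by case: (u).
- by move=> e /vx; rewrite inE negb_or => /andP[].
- by move=> e /vy; rewrite inE negb_or => /andP[].
- by rewrite cat_rcons.
- by rewrite cat_rcons.
Qed.

(** The symbol of [u] at index |x| goes to the first symbol of [v]. By its mirror position in
    [rev u], that symbol stands at index |u| - |x| - 1 of [y ++ rev v]; but it occurs there only at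
    the very end, at index |y| + |u| - 1. Hence |x| + |y| = 0. *)
Lemma return_cancel_short (T : eqType) (f : T -> T) (u v x y : seq T) :
    uniq v -> (forall a, a \in v -> a \notin y) -> size u = size v ->
    size x < size u ->
    map f (u ++ x) = x ++ v -> map f (rev u ++ y) = y ++ rev v ->
  x = [::] /\ y = [::].
Proof.
move=> uv vy szuv szx eqx eqy.
case: u v szuv szx uv vy eqx eqy => [|d u] [|b v] // szuv szx uv vy eqx eqy.
set n := size (d :: u) in szx szuv.
have nthx : f (nth d (d :: u) (size x)) = b.
  have := congr1 (nth b ^~ (size x)) eqx.
  rewrite nth_cat ltnn subnn /= -map_cons -cat_cons (nth_map d) ?size_cat; last by lia.
  by rewrite nth_cat szx.
have nthy : nth b (y ++ rev (b :: v)) (n - (size x).+1) = b.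
  rewrite -eqy (nth_map d) ?size_cat ?size_rev; last by rewrite -/n; lia.
  rewrite nth_cat size_rev -/n ifT; last by lia.
  rewrite nth_rev -/n; last by lia.
  by rewrite (_ : n - _ = size x); last by lia.
move: nthy; rewrite nth_cat; case: ltnP => szy.
  by move=> eqb; have /negP[] := vy b (mem_head _ _); rewrite -{1}eqb mem_nth.
rewrite nth_rev -szuv; last by lia.
set k := n - _; have kn : k < size (b :: v) by rewrite /k -szuv; lia.
move=> eqb; have := nth_uniq b kn (ltn0Sn _) uv.
rewrite eqb eqxx => /esym/eqP k0; rewrite /k in k0.
 have : size x + size y = 0 by lia.
by case: (x); case: (y).
Qed.

(** If neither [x] nor [y] is shorter than [u], then [x] begins with the image of [u] and [y] with
    the reverse of that image. Removing these prefixes leaves the same equations with the image of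
    [u] in place of [u], and the prefix becomes one block. *)
Lemma return_cancel (T : eqType) (f : T -> T) (u v x y : seq T) :
    u <> [::] -> uniq v -> size u = size v ->
    (forall a, a \in v -> a \notin x) -> (forall a, a \in v -> a \notin y) ->
    map f (u ++ x) = x ++ v -> map f (rev u ++ y) = y ++ rev v ->
  exists bs, [/\ all (fun b => size b == size u) bs,
    x = flatten bs & y = flatten (map rev bs)].
Proof.
have [n] := ubnP (size x).
elim: n x y u => // n IH x y u szn u0 uv szuv vx vy eqx eqy.
have ugt0 : 0 < size u by case: (u) u0.
case: (ltnP (size x) (size u)) => szx.
  by have [-> ->] := return_cancel_short uv vy szuv szx eqx eqy; exists [::].
case: (ltnP (size y) (size u)) => szy.
  (* The hypotheses are symmetric under exchanging [x] with [y] while reversing [u] and [v]. *)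
  have [||||||-> ->] := @return_cancel_short _ f (rev u) (rev v) y x;
    rewrite ?revK ?rev_uniq ?size_rev //.
    by move=> a; rewrite mem_rev; apply: vx.
  by exists [::].
move: eqx eqy.
rewrite !map_cat -{2}(cat_take_drop (size u) x) -{2}(cat_take_drop (size u) y).
rewrite -!catA => /cat_inj_size[|fu eqx]; first by rewrite size_map size_takel.
move=> /cat_inj_size[|fu' eqy]; first by rewrite size_map size_rev size_takel.
have [||||||||bs [szbs xbs ybs]] := IH (drop (size u) x) (drop (size u) y) (map f u).
- by rewrite size_drop; lia.
- by case: (u) u0.
- by [].
- by rewrite size_map.
- by move=> a /vx; apply: contra; apply: mem_drop.
- by move=> a /vy; apply: contra; apply: mem_drop.
- by rewrite fu cat_take_drop.
- by rewrite -map_rev fu' cat_take_drop.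
exists (map f u :: bs); split.
- by rewrite /= size_map eqxx -(size_map f u).
- by rewrite /= fu -xbs cat_take_drop.
- by rewrite /= -map_rev fu' -ybs cat_take_drop.
Qed.

(** * Recognizing [Int] and [Nes] from a list of blocks *)

Lemma flatten_blocks nu s h :
  flatten [seq block nu i | i <- iota s.+1 h] = iota (s * nu + 1) (h * nu).
Proof.
elim: h s => //= h IH s; rewrite IH mulSn iotaD /block subn1 /=.
by congr (_ ++ iota _ _); lia.
Qed.

(** A list of words is determined by its concatenation and the lengths of its members, so renaming
    the concatenation to 1, 2, ... sends each member to the right block. *)
Lemma equivalent_blocks nu (bs : seq (seq nat)) :
    all (fun b => size b == nu) bs -> uniq (flatten bs) ->
    is_word (flatten bs) ->
  exists f, [/\ bijective f, f 0 = 0 &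
    map (map f) bs = [seq block nu i | i <- iota 1 (size bs)]].
Proof.
move=> szbs ub wb; have [f [bf f0 fb]] := equivalent_iota ub wb.
exists f; split=> //; apply: eq_from_flatten_shape.
  rewrite -map_flatten fb flatten_blocks size_flatten; congr iota.
  elim: (bs) szbs => //= b bs' IH /andP[/eqP-> /IH ->]; lia.
have szb : shape (map (map f) bs) = nseq (size bs) nu.
  by elim: (bs) szbs => //= b bs' IH /andP[/eqP szb /IH ->]; rewrite size_map szb.
rewrite szb; elim: (size bs) 1 => //= h IH i.
by rewrite -IH size_iota.
Qed.

Lemma size_blocks (nu : nat) (bs : seq (seq nat)) :
  all (fun b => size b == nu) bs -> size (flatten bs) = size bs * nu.
Proof.
by elim: bs => //= b bs IH /andP[/eqP szb /IH eqbs]; rewrite size_cat szb eqbs.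
Qed.

Lemma map_flatten_rev (T U : Type) (f : T -> U) bs :
  map f (flatten (map rev bs)) = flatten (map rev (map (map f) bs)).
Proof.
rewrite map_flatten -!map_comp; congr flatten.
by apply: eq_map => b /=; rewrite map_rev.
Qed.

Lemma equivalent_Int nu bs :
    all (fun b => size b == nu) bs -> uniq (flatten bs) ->
    is_word (flatten bs) ->
  equivalent (flatten bs ++ flatten (map rev bs)) (Int (size bs) nu).
Proof.
move=> szbs ub wb; have [f [bf f0 fb]] := equivalent_blocks szbs ub wb.
exists f; split=> //.
by rewrite map_cat map_flatten map_flatten_rev fb /Int -map_comp.
Qed.

Lemma equivalent_Nes nu bs :
    all (fun b => size b == nu) bs -> uniq (flatten bs) ->
    is_word (flatten bs) ->
  equivalent (flatten bs ++ flatten (rev bs)) (Nes (size bs) nu).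
Proof.
move=> szbs ub wb; have [f [bf f0 fb]] := equivalent_blocks szbs ub wb.
exists f; split=> //.
by rewrite map_cat !map_flatten map_rev fb /Nes map_rev.
Qed.

Lemma perm_flatten_rev (T : eqType) (bs : seq (seq T)) :
  perm_eq (flatten bs) (flatten (map rev bs)).
Proof. by elim: bs => //= b bs IH; rewrite perm_cat // perm_sym perm_rev. Qed.

(** * Insertions, tangled cords and the sequential equation *)

Lemma mem_max_symbol a w : a \in w -> a <= max_symbol w.
Proof.
rewrite /max_symbol; elim: w => //= b w IH; rewrite inE big_cons leq_max.
by case/orP => [/eqP->|/IH->]; rewrite ?leqnn ?orbT.
Qed.

Lemma new_symbols a w nu : a \in iota (max_symbol w + 1) nu -> a \notin w.
Proof.
by rewrite mem_iota => /andP[lta _]; apply/negP => /mem_max_symbol; lia.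
Qed.

Lemma insert_cat c nu k l x y z :
    k - 1 = size x -> l - 1 = size (x ++ y) ->
  let w := x ++ y ++ z in let u := iota (max_symbol w + 1) nu in
  insert w (Insertion c nu k l) = x ++ u ++ y ++ twist c u ++ z.
Proof.
rewrite /insert /= => -> ->.
by rewrite take_size_cat // (catA x y z) take_size_cat // !drop_size_cat.
Qed.

Definition tangled c := match c with Repeat => T_rho | Return => T_tau end.

Lemma tangledS c nu m j (s := tangled c nu m j) :
  tangled c nu m j.+1 =
  insert s (Insertion c nu (size s - m + 1) (size s + 1)).
Proof. by case: c @s. Qed.

(** One step of a tangled cord, up to renaming: [v] is matched with the new symbols that the
    insertion into [s] adds, and the second copy goes to the end. *)
Lemma equivalent_insert c x y v s :
    equivalent (x ++ y) s -> is_word (x ++ y) -> is_word v -> uniq v ->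
    (forall a, a \in v -> a \notin x ++ y) ->
  equivalent (x ++ v ++ y ++ twist c v)
    (insert s (Insertion c (size v) (size s - size y + 1) (size s + 1))).
Proof.
move=> exy wxy wv uv vxy; set u := iota (max_symbol s + 1) (size v).
have wu : is_word u by rewrite /is_word mem_iota; lia.
have [|a|f [bf f0 fxy fv]] :=
  equivalent_extend exy wxy wv wu uv (iota_uniq _ _) _ vxy.
- by rewrite size_iota.
- exact: new_symbols.
exists f; split=> //.
have szs : size s = size x + size y by rewrite -fxy size_map size_cat.
have eqs : s = map f x ++ map f y ++ [::] by rewrite cats0 -map_cat.
rewrite {1}eqs insert_cat ?size_cat ?size_map; try lia.
by rewrite -eqs !map_cat map_twist fv cats0.
Qed.

(* If [0 < |z2| < 2|u|], the factor of the left-hand word that [f] sends to [v]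
   overlaps [twist c u], so a symbol of [u] would occur once more at the end. *)
Lemma no_short_middle (T : eqType) c (f : T -> T) (u v z1 z2 z3 : seq T) :
    injective f -> uniq u -> size u = size v -> z2 <> [::] ->
    (forall a, a \in u -> a \notin z1 ++ z2 ++ z3) ->
    map f (u ++ z1 ++ twist c u ++ z2 ++ z3) = z1 ++ z2 ++ v ++ z3 ++ twist c v ->
  2 * size u <= size z2.
Proof.
move=> injf uu szuv z20 udisj eqf; rewrite leqNgt; apply/negP => sz2.
have z2gt0 : 0 < size z2 by case: (z2) z20.
case: u => [|d u] in uu szuv udisj eqf sz2 *; first by rewrite /= in sz2.
set u1 := d :: u in uu szuv udisj eqf sz2.
set W1 := u1 ++ _ in eqf.
set nu := size u1 in szuv sz2.
have nugt0 : 0 < nu by [].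
(* By truncated subtraction [p] is |z1| + max(|z2|, |u|), the first position where [v] on the right
   faces [twist c u] on the left. *)
pose p := (size z2 - nu) + nu + size z1.
have szW : size W1 = 2 * nu + size z1 + size z2 + size z3.
  by rewrite /W1 !size_cat size_twist -/nu; lia.
pose i := p - (size z1 + size z2).
have fp : nth d (map f W1) p = nth d v i.
  rewrite eqf catA nth_cat size_cat -/i ifF; last by apply/negbTE; rewrite -leqNgt /p; lia.
  by rewrite nth_cat ifT // /i /p -szuv; lia.
have iv : i < size v by rewrite /i /p -szuv; lia.
have : nth d v i \in twist c v by rewrite mem_twist mem_nth.
case/(nthP d) => j; rewrite size_twist -szuv => jnu vj.
(* The position of the same symbol of [v] inside the final [twist c v]. *)
pose q := size z1 + size z2 + size z3 + nu + j.
have fq : nth d (map f W1) q = nth d v i.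
  rewrite eqf !nth_cat -szuv !ifF -?vj; try by apply/negbTE; rewrite -leqNgt /q; lia.
  by congr nth; rewrite /q; lia.
have W1pq : nth d W1 p = nth d W1 q.
  apply: injf; rewrite -!(nth_map d d f) ?szW ?fp ?fq // /p /q; lia.
have W1p : nth d W1 p = nth d (twist c u1) (size z2 - nu).
  rewrite /W1 catA nth_cat size_cat -/nu ifF; last by apply/negbTE; rewrite -leqNgt /p; lia.
  rewrite nth_cat size_twist -/nu ifT; last by rewrite /p; lia.
  by congr nth; rewrite /p; lia.
have p_lt : size z2 - nu < size (twist c u1) by rewrite size_twist -/nu; lia.
pose q' := q - (nu + size z1).
have W1q : nth d W1 q = nth d (twist c u1 ++ z2 ++ z3) q'.
  by rewrite /W1 catA nth_cat size_cat -/nu ifF //; apply/negbTE; rewrite -leqNgt /q; lia.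
(* On the left, [q] falls either in [twist c u] at another index, against uniqueness, or in
   [z2 ++ z3], which contains no symbol of [u]. *)
move: W1pq; rewrite W1p W1q nth_cat; case: ltnP => q_lt.
  move/eqP; rewrite nth_uniq ?uniq_twist // => /eqP; rewrite /q' /q; lia.
move=> eqpq; have /udisj/negP[] : nth d (twist c u1) (size z2 - nu) \in u1.
  by rewrite -(mem_twist c) mem_nth.
rewrite mem_cat eqpq mem_nth ?orbT //.
by move: q_lt; rewrite size_twist size_cat -/nu /q' /q; lia.
Qed.

(* Comparing the factors in front of, in and between the two copies of [v]
   shows that the last [2|u|] symbols of [z2] and [z3] have the form
   [v' ++ y ++ twist c v']; deleting both copies of [v'] leaves a shorter
   solution of the same equation. *)
Lemma peel_insertion (T : eqType) c (f : T -> T) (u v z1 z2 z3 : seq T) :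
    injective f -> uniq v -> size u = size v -> 2 * size u <= size z2 ->
    (forall a, a \in v -> a \notin z1 ++ z2 ++ z3) ->
    map f (u ++ z1 ++ twist c u ++ z2 ++ z3) = z1 ++ z2 ++ v ++ z3 ++ twist c v ->
  exists x v' y,
    [/\ z2 ++ z3 = x ++ v' ++ y ++ twist c v', size z2 = size x + 2 * size u,
        size y = size z3, size v' = size u & uniq v'] /\
    (forall a, a \in v' -> a \notin z1 ++ x ++ y) /\
    map f (u ++ z1 ++ twist c u ++ x ++ y) = z1 ++ x ++ v' ++ y ++ twist c v'.
Proof.
move=> injf uv szuv sz2 vdisj eqf.
(* The cuts are made so that [f] sends [u ++ z1 ++ twist c u ++ x] to [z1 ++ z2], then [v'] to [v],
   [y] to [z3] and [t] to [twist c v]. *)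
pose x := take (size z2 - 2 * size u) z2.
pose r := drop (size z2 - 2 * size u) z2 ++ z3.
have szx : size x = size z2 - 2 * size u by rewrite size_takel //; lia.
have szr : size r = 2 * size u + size z3 by rewrite size_cat size_drop; lia.
have eqr : z2 ++ z3 = x ++ r by rewrite catA cat_take_drop.
pose v' := take (size u) r; pose r' := drop (size u) r.
pose y := take (size z3) r'; pose t := drop (size z3) r'.
have szv' : size v' = size u by rewrite size_takel //; lia.
have szr' : size r' = size u + size z3 by rewrite size_drop; lia.
have szy : size y = size z3 by rewrite size_takel //; lia.
have eqr' : r = v' ++ y ++ t by rewrite !cat_take_drop.
move: eqf; rewrite eqr eqr' (catA z1 z2) (catA z1) (catA u) (catA _ x) map_cat.
move=> /cat_inj_size[|fhead].
  by rewrite size_map !size_cat size_twist; lia.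
rewrite map_cat => /cat_inj_size[|fv']; first by rewrite size_map szv'.
rewrite map_cat => /cat_inj_size[|fy]; first by rewrite size_map szy.
rewrite -fv' -map_twist => /(inj_map injf) eqt.
have feq : map f (u ++ z1 ++ twist c u ++ x ++ y) = z1 ++ z2 ++ z3.
  by rewrite -fy (catA z1 z2) -fhead -map_cat -!catA.
exists x, v', y; split; last split.
- split=> //; first by rewrite eqt.
    by rewrite szx; lia.
  by rewrite -(map_inj_uniq injf) fv'.
(* A symbol shared by [v'] and [z1 ++ x ++ y] would have its image both in [v] and in
   [z1 ++ z2 ++ z3]. *)
- move=> a av'; have : f a \in v by rewrite -fv' map_f.
  move=> /vdisj; apply: contra => axy; rewrite -feq map_f //.
  by move: axy; rewrite !mem_cat => /or3P[] ->; rewrite ?orbT.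
- by rewrite feq eqr eqr' eqt.
Qed.

(** With an empty middle factor the sequential equation splits into the two that the cancellation
    lemmas solve, and their solutions are the initial words of the cords. *)
Lemma tangled_base c (f : nat -> nat) (u v x y : seq nat) :
    u <> [::] -> uniq v -> size u = size v ->
    (forall a, a \in v -> a \notin x ++ y) -> is_word (x ++ y) ->
    (forall a, count_mem a (x ++ y) <= 2) ->
    map f (u ++ x ++ twist c u ++ y) = x ++ v ++ y ++ twist c v ->
  [/\ size y = size x, c = Return -> size u %| size x &
      equivalent (x ++ y) (tangled c (size u) (size x) 0)].
Proof.
move=> u0 uv szuv vdisj wxy le2.
have vx a : a \in v -> a \notin x by move=> /vdisj; rewrite mem_cat negb_or => /andP[].
have vy a : a \in v -> a \notin y by move=> /vdisj; rewrite mem_cat negb_or => /andP[].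
have wx : is_word x by move: wxy; rewrite /is_word mem_cat negb_or => /andP[].
rewrite catA map_cat (catA x) => /cat_inj_size[|eqx eqy].
  by rewrite size_map !size_cat; lia.
case: c eqx eqy => /= eqx eqy.
  have eqxy := repeat_cancel u0 vx vy eqx eqy; rewrite -eqxy in le2 *.
  split=> //; have ux := uniq_perm_halves (perm_refl x) le2.
  have [f' [bf f0 fx]] := equivalent_iota ux wx.
  by exists f'; rewrite map_cat fx.
have [bs [szbs eqx' eqy']] := return_cancel u0 uv szuv vx vy eqx eqy.
have ux : uniq x.
  by apply: uniq_perm_halves le2; rewrite eqx' eqy' perm_flatten_rev.
have szx := size_blocks szbs; rewrite -eqx' in szx.
have u_gt0 : 0 < size u by case: (u) u0.
split.
- by rewrite eqx' eqy'; apply/esym/perm_size/perm_flatten_rev.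
- by rewrite szx dvdn_mull.
- rewrite szx mulnK // eqx' eqy'; apply: equivalent_Int; by rewrite -?eqx'.
Qed.

(** Induction on |z2|: [peel_insertion] gives a shorter solution and [equivalent_insert] restores
    the removed insertion. Separate words [u] and [v] are needed because peeling keeps [u] but
    replaces [v] by [v']. *)
Lemma tangled_cord c (f : nat -> nat) (u v z1 z2 z3 : seq nat) :
    injective f -> u <> [::] -> uniq u -> uniq v -> size u = size v ->
    (forall a, a \in u -> a \notin z1 ++ z2 ++ z3) ->
    (forall a, a \in v -> a \notin z1 ++ z2 ++ z3) ->
    is_word (z1 ++ z2 ++ z3) ->
    (forall a, count_mem a (z1 ++ z2 ++ z3) <= 2) ->
    map f (u ++ z1 ++ twist c u ++ z2 ++ z3) = z1 ++ z2 ++ v ++ z3 ++ twist c v ->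
  exists j, [/\ size z2 = j * (2 * size u), size z3 = size z1,
    c = Return -> size u %| size z1 &
    equivalent (z1 ++ z2 ++ z3) (tangled c (size u) (size z1) j)].
Proof.
move=> injf u0 uu; have [n] := ubnP (size z2).
elim: n z2 z3 v => // n IH z2 z3 v szn uv szuv udisj vdisj wz le2 eqf.
have u_gt0 : 0 < size u by case: (u) u0.
case: (z2 =P [::]) => [z2nil|z2n0].
  rewrite z2nil /= in vdisj wz le2 eqf *.
  by have [sz dv eqv] := tangled_base u0 uv szuv vdisj wz le2 eqf; exists 0.
have sz2 := no_short_middle injf uu szuv z2n0 udisj eqf.
have [x [v' [y [[eqz szx szy szv' uv'] [v'disj eqf']]]]] :=
  peel_insertion injf uv szuv sz2 vdisj eqf.
(* Deleting both copies of [v'] leaves a subsequence, which inherits the conditions on symbols and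
   their multiplicities. *)
have sub : subseq (z1 ++ x ++ y) (z1 ++ z2 ++ z3).
  rewrite eqz cat_subseq // cat_subseq // -[y]/([::] ++ y) cat_subseq ?sub0seq //.
  exact: prefix_subseq.
have wxy : is_word (z1 ++ x ++ y) by apply: contra wz; apply: mem_subseq.
have [||||||||j [szxj szyz dv eqv]] := IH x y v'.
- by rewrite -ltnS; apply: leq_trans szn; rewrite szx ltnS -addn1 leq_add2l muln_gt0.
- by [].
- by rewrite szv'.
- by move=> a /udisj; apply: contra; apply: mem_subseq.
- exact: v'disj.
- exact: wxy.
- by move=> a; apply: leq_trans (count_subseq _ sub) (le2 a).
- exact: eqf'.
exists j.+1; split=> //; first by rewrite mulSn -szxj szx addnC.
  by rewrite -szy.
(* Since |y| = |z1|, the first copy of [v'] stands just before the last |z1| symbols of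
   [z1 ++ x ++ y], exactly where the cord inserts. *)
rewrite eqz tangledS -szyz -szv' (catA z1 x); rewrite -szv' -szyz in eqv.
rewrite catA in eqv wxy v'disj.
apply: equivalent_insert => //.
apply: contra wz; rewrite eqz !mem_cat => ->; by rewrite !orbT.
Qed.

(** * From equivalent insertions to equations between factors *)

(** A word of one symbol is its own reverse, so for [nu_of I = 1] the kind can be chosen freely. *)
Lemma insert_kind c w I : kind_of I = c \/ nu_of I = 1 ->
  insert w I = insert w (Insertion c (nu_of I) (k_of I) (l_of I)).
Proof. by case: I => -[] nu k l /= [<-|->] //; case: c. Qed.

Lemma sort_leq_eq s t : perm_eq s t -> sorted leq t -> sort leq s = t.
Proof.
move=> pst srt; apply: (sorted_eq leq_trans anti_leq (sort_sorted leq_total s)) => //.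
by rewrite perm_sort.
Qed.

Lemma interleaved_split c (f : nat -> nat) nu k1 l1 k2 l2 z0 z1 z2 z3 z4
    (w := z0 ++ z1 ++ z2 ++ z3 ++ z4) (u := iota (max_symbol w + 1) nu) :
    size z0 = k1 - 1 -> size (z0 ++ z1) = k2 - 1 ->
    size (z0 ++ z1 ++ z2) = l1 - 1 -> size (z0 ++ z1 ++ z2 ++ z3) = l2 - 1 ->
    map f (insert w (Insertion c nu k1 l1)) = insert w (Insertion c nu k2 l2) ->
  map f (u ++ z1) = z1 ++ u /\ map f (twist c u ++ z3) = z3 ++ twist c u.
Proof.
move=> sz0 sz01 sz02 sz03.
have ins1 := @insert_cat c nu k1 l1 z0 (z1 ++ z2) (z3 ++ z4) (esym sz0) (esym sz02).
have szl2 : l2 - 1 = size ((z0 ++ z1) ++ z2 ++ z3) by rewrite -sz03 -!catA.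
have ins2 := @insert_cat c nu k2 l2 (z0 ++ z1) (z2 ++ z3) z4 (esym sz01) szl2.
rewrite /= -!catA -/w -/u in ins1 ins2; rewrite ins1 ins2 => eqw.
have : map f (z0 ++ (u ++ z1) ++ z2 ++ (twist c u ++ z3) ++ z4)
    = z0 ++ (z1 ++ u) ++ z2 ++ (z3 ++ twist c u) ++ z4 by rewrite -!catA.
rewrite map_cat => /cat_inj_size[|_]; first by rewrite size_map.
rewrite map_cat => /cat_inj_size[|->]; first by rewrite size_map !size_cat addnC.
rewrite map_cat => /cat_inj_size[|_]; first by rewrite size_map.
by rewrite map_cat => /cat_inj_size[|-> _]; first by rewrite size_map !size_cat addnC.
Qed.

Lemma nested_split c (f : nat -> nat) nu k1 l1 k2 l2 z0 z1 z2 z3 z4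
    (w := z0 ++ z1 ++ z2 ++ z3 ++ z4) (u := iota (max_symbol w + 1) nu) :
    size z0 = k1 - 1 -> size (z0 ++ z1) = k2 - 1 ->
    size (z0 ++ z1 ++ z2) = l2 - 1 -> size (z0 ++ z1 ++ z2 ++ z3) = l1 - 1 ->
    map f (insert w (Insertion c nu k1 l1)) = insert w (Insertion c nu k2 l2) ->
  map f (u ++ z1) = z1 ++ u /\ map f (z3 ++ twist c u) = twist c u ++ z3.
Proof.
move=> sz0 sz01 sz02 sz03.
have ins1 := @insert_cat c nu k1 l1 z0 (z1 ++ z2 ++ z3) z4 (esym sz0) (esym sz03).
have szl2 : l2 - 1 = size ((z0 ++ z1) ++ z2) by rewrite -sz02 -!catA.
have ins2 := @insert_cat c nu k2 l2 (z0 ++ z1) z2 (z3 ++ z4) (esym sz01) szl2.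
rewrite /= -!catA -/w -/u in ins1 ins2; rewrite ins1 ins2 => eqw.
have : map f (z0 ++ (u ++ z1) ++ z2 ++ (z3 ++ twist c u) ++ z4)
    = z0 ++ (z1 ++ u) ++ z2 ++ (twist c u ++ z3) ++ z4 by rewrite -!catA.
rewrite map_cat => /cat_inj_size[|_]; first by rewrite size_map.
rewrite map_cat => /cat_inj_size[|->]; first by rewrite size_map !size_cat addnC.
rewrite map_cat => /cat_inj_size[|_]; first by rewrite size_map.
by rewrite map_cat => /cat_inj_size[|-> _]; first by rewrite size_map !size_cat addnC.
Qed.

(** Both inserted copies precede [z2] in one word and follow it in the other, so [z2] itself is
    displaced and only the ends [z0] and [z4] line up. *)
Lemma sequential_split c (f : nat -> nat) nu k1 l1 k2 l2 z0 z1 z2 z3 z4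
    (w := z0 ++ z1 ++ z2 ++ z3 ++ z4) (u := iota (max_symbol w + 1) nu) :
    size z0 = k1 - 1 -> size (z0 ++ z1) = l1 - 1 ->
    size (z0 ++ z1 ++ z2) = k2 - 1 -> size (z0 ++ z1 ++ z2 ++ z3) = l2 - 1 ->
    map f (insert w (Insertion c nu k1 l1)) = insert w (Insertion c nu k2 l2) ->
  map f (u ++ z1 ++ twist c u ++ z2 ++ z3) = z1 ++ z2 ++ u ++ z3 ++ twist c u.
Proof.
move=> sz0 sz01 sz02 sz03.
have ins1 := @insert_cat c nu k1 l1 z0 z1 (z2 ++ z3 ++ z4) (esym sz0) (esym sz01).
have szl2 : l2 - 1 = size ((z0 ++ z1 ++ z2) ++ z3) by rewrite -sz03 -!catA.
have ins2 := @insert_cat c nu k2 l2 (z0 ++ z1 ++ z2) z3 z4 (esym sz02) szl2.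
rewrite /= -!catA -/w -/u in ins1 ins2; rewrite ins1 ins2 => eqw.
have : map f (z0 ++ (u ++ z1 ++ twist c u ++ z2 ++ z3) ++ z4)
    = z0 ++ (z1 ++ z2 ++ u ++ z3 ++ twist c u) ++ z4 by rewrite -!catA.
rewrite map_cat => /cat_inj_size[|_]; first by rewrite size_map.
rewrite map_cat => /cat_inj_size[|-> _] //.
by rewrite size_map !size_cat size_twist; lia.
Qed.

(** * The three relative positions and the six conclusions *)

Theorem theorem4p1 (w : seq nat) (nu : nat) (c1 c2 : ins_kind)
    (k1 l1 k2 l2 : nat) (p1 p2 p3 p4 : nat) (z0 z1 z2 z3 z4 : seq nat) :
  let I1 := Insertion c1 nu k1 l1 in
  let I2 := Insertion c2 nu k2 l2 in
  DOW w -> ascending w -> 1 <= nu ->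
  valid_insertion w I1 -> valid_insertion w I2 ->
  (k1, l1) <> (k2, l2) -> k1 < k2 ->
  [:: p1; p2; p3; p4] = sort leq [:: k1; l1; k2; l2] ->
  w = z0 ++ z1 ++ z2 ++ z3 ++ z4 ->
  size z0 = p1 - 1 ->
  size (z0 ++ z1) = p2 - 1 ->
  size (z0 ++ z1 ++ z2) = p3 - 1 ->
  size (z0 ++ z1 ++ z2 ++ z3) = p4 - 1 ->
  equivalent (insert w I1) (insert w I2) ->
  (* (a) *)
  (k1 < k2 /\ k2 <= l1 /\ l1 < l2 -> in_Rep I1 /\ in_Rep I2 ->
    repeat_word (z1 ++ z3)) /\
  (* (b) *)
  (k1 < k2 /\ k2 <= l1 /\ l1 < l2 -> in_Ret I1 /\ in_Ret I2 ->
    nu %| size z1 /\ 0 < size z1 %/ nu /\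
    equivalent (z1 ++ z3) (Int (size z1 %/ nu) nu)) /\
  (* (c) *)
  (k1 < k2 /\ k2 <= l2 /\ l2 < l1 -> in_Rep I1 /\ in_Rep I2 ->
    nu %| size z1 /\ 0 < size z1 %/ nu /\
    equivalent (z1 ++ z3) (Nes (size z1 %/ nu) nu)) /\
  (* (d) *)
  (k1 < k2 /\ k2 <= l2 /\ l2 < l1 -> in_Ret I1 /\ in_Ret I2 ->
    return_word (z1 ++ z3)) /\
  (* (e) *)
  (k1 <= l1 /\ l1 < k2 /\ k2 <= l2 -> in_Rep I1 /\ in_Rep I2 ->
    2 * nu %| size z2 /\ 0 < size z2 %/ (2 * nu) /\
    equivalent (z1 ++ z2 ++ z3)
      (T_rho nu (size z1) (size z2 %/ (2 * nu)))) /\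
  (* (f) *)
  (k1 <= l1 /\ l1 < k2 /\ k2 <= l2 -> in_Ret I1 /\ in_Ret I2 ->
    2 * nu %| size z2 /\ 0 < size z2 %/ (2 * nu) /\ nu %| size z1 /\
    equivalent (z1 ++ z2 ++ z3)
      (T_tau nu (size z1) (size z2 %/ (2 * nu)))).
Proof.
move=> I1 I2 [ww wcount] _ nu_gt0 [_ k1_gt0 kl1 _] [_ k2_gt0 kl2 _] _ k12 psort wz
  sz0 sz01 sz02 sz03 [f [bf _ eqf]].
rewrite /= in k1_gt0 k2_gt0 kl1 kl2.
have injf := bij_inj bf.
pose u := iota (max_symbol w + 1) nu.
have szu : size u = nu by rewrite size_iota.
have u0 : u <> [::] by move=> eqn; rewrite eqn in szu; rewrite -szu in nu_gt0.
have uu : uniq u := iota_uniq _ _.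
have eqins c : (kind_of I1 = c \/ nu_of I1 = 1) /\ (kind_of I2 = c \/ nu_of I2 = 1) ->
    map f (insert w (Insertion c nu k1 l1)) = insert w (Insertion c nu k2 l2).
  by case=> /insert_kind eq1 /insert_kind eq2; rewrite -eq1 -eq2.
have sub13 : subseq (z1 ++ z3) w.
  rewrite wz -[z1 ++ z3]/([::] ++ z1 ++ [::] ++ z3) !cat_subseq ?sub0seq //.
  exact: prefix_subseq.
have sub123 : subseq (z1 ++ z2 ++ z3) w.
  rewrite wz; apply: subseq_trans (suffix_subseq z0 _).
  by rewrite (catA z2) (catA z1 (z2 ++ z3)) prefix_subseq.
have u_new s : subseq s w -> forall a, a \in u -> a \notin s.
  by move=> sub a /new_symbols; apply: contra; apply: mem_subseq.
have word s : subseq s w -> is_word s.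
  by move=> sub; apply: contra ww; apply: mem_subseq.
have le2 s : subseq s w -> forall a, count_mem a s <= 2.
  move=> sub a; apply: leq_trans (count_subseq _ sub) _.
  by case: (wcount a) => ->.
have sub1 : subseq z1 w := subseq_trans (prefix_subseq _ _) sub13.
have sub3 : subseq z3 w := subseq_trans (suffix_subseq _ _) sub13.
(* Positions count from 1; for [p1 = 0] and [p2 = 1] the truncated differences [p1 - 1] and [p2 - 1]
   would agree. *)
have z1_gt0 : p1 < p2 -> 0 < p1 -> 0 < size z1.
  by move: sz01; rewrite size_cat sz0; lia.
have interleaved c : k1 < k2 /\ k2 <= l1 /\ l1 < l2 ->
    (kind_of I1 = c \/ nu_of I1 = 1) /\ (kind_of I2 = c \/ nu_of I2 = 1) ->
    [/\ 0 < size z1, map f (u ++ z1) = z1 ++ u &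
        map f (twist c u ++ z3) = z3 ++ twist c u].
  move=> [_ [k2l1 l12]] /eqins eqw; move: psort.
  rewrite (_ : sort _ _ = [:: k1; k2; l1; l2]); last first.
    apply: sort_leq_eq; last by rewrite /= k2l1 (ltnW k12) (ltnW l12).
    by rewrite perm_cons; apply/permPl/(perm_catCA [:: l1] [:: k2]).
  case=> e1 e2 e3 e4; subst p1 p2 p3 p4; split; first exact: z1_gt0.
    by rewrite /u wz in eqw *; have [] := interleaved_split sz0 sz01 sz02 sz03 eqw.
  by rewrite /u wz in eqw *; have [] := interleaved_split sz0 sz01 sz02 sz03 eqw.
have nested c : k1 < k2 /\ k2 <= l2 /\ l2 < l1 ->
    (kind_of I1 = c \/ nu_of I1 = 1) /\ (kind_of I2 = c \/ nu_of I2 = 1) ->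
    [/\ 0 < size z1, map f (u ++ z1) = z1 ++ u &
        map f (rev (twist c u) ++ rev z3) = rev z3 ++ rev (twist c u)].
  move=> [_ [k2l2 l21]] /eqins eqw; move: psort.
  rewrite (_ : sort _ _ = [:: k1; k2; l2; l1]); last first.
    apply: sort_leq_eq; last by rewrite /= k2l2 (ltnW k12) (ltnW l21).
    by rewrite perm_cons; apply/permPl/(perm_catC [:: l1] [:: k2; l2]).
  case=> e1 e2 e3 e4; subst p1 p2 p3 p4; split; first exact: z1_gt0.
    by rewrite /u wz in eqw *; have [] := nested_split sz0 sz01 sz02 sz03 eqw.
  (* Reversing the second nested equation gives the shape that the cancellation lemmas take. *)
  rewrite -!rev_cat map_rev; congr rev.
  by rewrite /u wz in eqw *; have [] := nested_split sz0 sz01 sz02 sz03 eqw.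
have sequential c : k1 <= l1 /\ l1 < k2 /\ k2 <= l2 ->
    (kind_of I1 = c \/ nu_of I1 = 1) /\ (kind_of I2 = c \/ nu_of I2 = 1) ->
    [/\ 2 * nu %| size z2, 0 < size z2 %/ (2 * nu), c = Return -> nu %| size z1 &
     equivalent (z1 ++ z2 ++ z3) (tangled c nu (size z1) (size z2 %/ (2 * nu)))].
  move=> [_ [l1k2 _]] /eqins eqw; move: psort.
  rewrite (_ : sort _ _ = [:: k1; l1; k2; l2]); last first.
    by apply: sort_leq_eq; last by rewrite /= kl1 kl2 (ltnW l1k2).
  case=> e1 e2 e3 e4; subst p1 p2 p3 p4.
  have z2_gt0 : 0 < size z2.
    by move: sz01 sz02; rewrite !size_cat; lia.
  have eqz : map f (u ++ z1 ++ twist c u ++ z2 ++ z3) = z1 ++ z2 ++ u ++ z3 ++ twist c u.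
    by rewrite /u wz in eqw *; apply: sequential_split eqw.
  (* The induction starts with both words equal to [u]. *)
  have [j [szj _ dv eqv]] := tangled_cord injf u0 uu uu erefl (u_new _ sub123)
    (u_new _ sub123) (word _ sub123) (le2 _ sub123) eqz.
  rewrite szu in szj dv eqv.
  have eqj : size z2 %/ (2 * nu) = j by rewrite szj mulnK ?muln_gt0.
  rewrite eqj szj dvdn_mull //; split=> //.
  by case: (j) szj z2_gt0 => // ->.
split; [|split; [|split; [|split; [|split]]]].
- move=> /interleaved /[apply] -[z1n0 eq1 eq3].
  have eq13 := repeat_cancel u0 (u_new _ sub1) (u_new _ sub3) eq1 eq3.
  have le13 := le2 _ sub13; rewrite -eq13 in le13 *.
  exists z1; split=> //; split; first exact: word.
    by case: (z1) z1n0.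
  exact: uniq_perm_halves le13.
- move=> /interleaved /[apply] -[z1n0 eq1 eq3].
  have [bs [szbs eq1' eq3']] :=
    return_cancel u0 uu erefl (u_new _ sub1) (u_new _ sub3) eq1 eq3.
  have uz1 : uniq z1.
    by apply: uniq_perm_halves (le2 _ sub13); rewrite eq1' eq3' perm_flatten_rev.
  have szz1 := size_blocks szbs; rewrite -eq1' szu in szz1.
  rewrite szu in szbs.
  have szh : size z1 %/ nu = size bs by rewrite szz1 mulnK.
  rewrite szh; split; first by rewrite szz1 dvdn_mull.
  split; first by case: (size bs) szz1 z1n0 => // ->.
  by rewrite eq1' eq3'; apply: equivalent_Int => //; rewrite -eq1' //; apply: word.
(* For repeat insertions the reversed equation contains [rev u], so [rev z3] consists of the
   reversed blocks of [z1]; undoing the reversal lists the blocks themselves in opposite order, as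
   in [Nes]. *)
- move=> /nested /[apply] -[z1n0 eq1 eq3].
  have u_new3 : forall a, a \in u -> a \notin rev z3.
    by move=> a; rewrite mem_rev; apply: u_new.
  have [bs [szbs eq1' eq3']] :=
    return_cancel u0 uu erefl (u_new _ sub1) u_new3 eq1 eq3.
  have uz1 : uniq z1.
    apply: uniq_perm_halves (le2 _ sub13); rewrite perm_sym -perm_rev perm_sym.
    by rewrite eq3' eq1' perm_flatten_rev.
  have szz1 := size_blocks szbs; rewrite -eq1' szu in szz1.
  rewrite szu in szbs.
  have szh : size z1 %/ nu = size bs by rewrite szz1 mulnK.
  rewrite szh; split; first by rewrite szz1 dvdn_mull.
  split; first by case: (size bs) szz1 z1n0 => // ->.
  have -> : z3 = flatten (rev bs).
    rewrite -[z3]revK eq3' rev_flatten -map_comp map_id_in // => b _ /=.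
    by rewrite revK.
  by rewrite eq1'; apply: equivalent_Nes => //; rewrite -eq1' //; apply: word.
(* For return insertions the two reversals of [u] cancel, which leaves the repeat equations for [z1]
   and [rev z3]. *)
- move=> /nested /[apply] -[z1n0 eq1]; rewrite /= revK => eq3.
  have u_new3 : forall a, a \in u -> a \notin rev z3.
    by move=> a; rewrite mem_rev; apply: u_new.
  have eq13 := repeat_cancel u0 (u_new _ sub1) u_new3 eq1 eq3.
  have le13 := le2 _ sub13; rewrite -[z3]revK -eq13 in le13 *.
  exists z1; split=> //; split; first exact: word.
    by case: (z1) z1n0.
  by apply: uniq_perm_halves le13; rewrite perm_sym perm_rev.
- by move=> /sequential /[apply] -[].
- by move=> /sequential /[apply] -[dv h_gt0 /(_ erefl) nuz1 eqv].
Qed.
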